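(* Let $n,m$ be positive integers, let $x_1<x_2<\dots<x_n$ and $y_1<y_2<\dots<y_m$ be real numbers, and let $Z=(z_{ij})\in\mathbb{R}^{n\times m}$. Put $P_{ij}:=(x_i,y_j,z_{ij})\in\mathbb{R}^3$ and define \[ A_i:=\operatorname{conv}\{P_{ij}: j\in[m]\}\quad (i\in[n]),\qquad B_j:=\operatorname{conv}\{P_{ij}: i\in[n]\}\quad (j\in[m]). \] Then either there is an $i\in[n]$ and a line contained in the plane $\{(x_i,s,t): s,t\in\mathbb{R}\}$ that intersects at least $\frac m6$ of the sets $B_1,\dots,B_m$, or there is a $j\in[m]$ and a line contained in the plane $\{(s,y_j,t): s,t\in\mathbb{R}\}$ that intersects at least $\frac n6$ of the sets $A_1,\dots,A_n$.
   Context: $[n]=\{1,\dots,n\}$. *)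

(* Defs.v *)
From HB Require Import structures.
From mathcomp Require Import all_boot all_order all_algebra.
From mathcomp Require Import reals.
Set Implicit Arguments. Unset Strict Implicit. Unset Printing Implicit Defensive.
Import Order.TTheory GRing.Theory Num.Theory.
Local Open Scope ring_scope.

Definition pt3 (R : realType) := (R * R * R)%type.
Definition px {R : realType} (p : pt3 R) : R := p.1.1.
Definition py {R : realType} (p : pt3 R) : R := p.1.2.
Definition pz {R : realType} (p : pt3 R) : R := p.2.

Definition in_conv {R : realType} {I : finType} (P : I -> pt3 R) (q : pt3 R) : Prop :=
  exists l : I -> R,
    (forall k, 0 <= l k) /\ \sum_k l k = 1 /\
    q = (\sum_k l k * px (P k), \sum_k l k * py (P k), \sum_k l k * pz (P k)).

(* q lies on the line {p + t d : t in R} (a genuine line when d <> 0). *)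
Definition on_line {R : realType} (p d q : pt3 R) : Prop :=
  exists t : R, q = (px p + t * px d, py p + t * py d, pz p + t * pz d).

Definition Pt {R : realType} {n m : nat} (x : 'I_n -> R) (y : 'I_m -> R)
  (z : 'M[R]_(n, m)) (i : 'I_n) (j : 'I_m) : pt3 R := (x i, y j, z i j).

(* Main.v *)
(* The plane x = x_i cuts each B_j in a vertical segment.  For a triple of rows
   with median i and a triple of columns with median j, either the segments of
   the three B's in the plane x = x_i or those of the three A's in the plane
   y = y_j have a common transversal: if neither do, then z_ij, the
   interpolations v of row i and w of column j, and the bilinear interpolation
   c of the four corners satisfy {z_ij, w} > {v, c} or {z_ij, w} < {v, c}, and
   likewise {z_ij, v} > {w, c} or {z_ij, v} < {w, c}, elementwise; each
   combination is contradictory.  Hence some row (or column) is good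
   for at least half of all triples.  If three segments have a transversal, then
   for one of the three pairs the line of least slope meeting that pair meets the
   third segment as well, so one of the m^2 least-slope lines serves for at
   least (m^3 / 2) / (3 m^2) = m / 6 segments.  Ordered triples and pairs with
   repetitions are allowed throughout, which makes these counts exact. *)
Require Import Defs.
From HB Require Import structures.
From mathcomp Require Import all_boot all_order all_algebra.
From mathcomp Require Import reals.
From mathcomp Require Import ring lra zify.
Set Implicit Arguments. Unset Strict Implicit. Unset Printing Implicit Defensive.
Import Order.TTheory GRing.Theory Num.Theory.
Local Open Scope ring_scope.

(** * Double counting *)

Lemma sum_mulS (T : finType) (c : nat) (F : T -> nat) :
  (\sum_(t : T) (c * F t).+1 = c * \sum_t F t + #|T|)%N.
Proof.
by under eq_bigr do rewrite -addn1; rewrite big_split /= -big_distrr sum1_card.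
Qed.

(** If both alternatives fail, each relation holds for strictly less than half of all pairs, so
    together they cannot cover them. *)
Lemma pigeonhole_half (X Y : finType) (R1 R2 : X -> Y -> bool) :
  (0 < #|X|)%N -> (0 < #|Y|)%N -> (forall a b, R1 a b || R2 a b) ->
  (exists a, #|Y| <= 2 * #|[set b | R1 a b]|)%N \/
  (exists b, #|X| <= 2 * #|[set a | R2 a b]|)%N.
Proof.
move=> X0 Y0 R12.
have [/existsP[a Ha]|/existsPn N1] := boolP [exists a, #|Y| <= 2 * #|[set b | R1 a b]|]%N.
  by left; exists a.
have [/existsP[b Hb]|/existsPn N2] := boolP [exists b, #|X| <= 2 * #|[set a | R2 a b]|]%N.
  by right; exists b.
exfalso.
have E1 : (#|X| * #|Y| <=
    \sum_(a : X) #|[set b | R1 a b]| + \sum_(b : Y) #|[set a | R2 a b]|)%N.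
  have -> : (\sum_(a : X) #|[set b | R1 a b]| = \sum_(a : X) \sum_(b : Y) R1 a b)%N.
    by apply: eq_bigr => a _; rewrite cardsE -sum1_card big_mkcond.
  have -> : (\sum_(b : Y) #|[set a | R2 a b]| = \sum_(a : X) \sum_(b : Y) R2 a b)%N.
    rewrite exchange_big /=.
    by apply: eq_bigr => b _; rewrite cardsE -sum1_card big_mkcond.
  rewrite -big_split -sum_nat_const /=; apply: leq_sum => a _.
  rewrite -big_split -sum1_card /=; apply: leq_sum => b _.
  by have := R12 a b; case: (R1 a b); case: (R2 a b).
have E2 : (2 * \sum_(a : X) #|[set b | R1 a b]| + #|X| <= #|X| * #|Y|)%N.
  by rewrite -sum_mulS -sum_nat_const; apply: leq_sum => a _; rewrite ltnNge.
have E3 : (2 * \sum_(b : Y) #|[set a | R2 a b]| + #|Y| <= #|Y| * #|X|)%N.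
  by rewrite -sum_mulS -sum_nat_const; apply: leq_sum => b _; rewrite ltnNge.
lia.
Qed.

(** * Linear interpolation and convex combinations in the plane *)

Section Interpolation.
Variable R : realType.
Implicit Types s t a b r v : R.

(* For [s = t] this is the constant [a], since division by 0 gives 0. *)
Definition interp s t a b r := a + (b - a) / (t - s) * (r - s).

Lemma interpl s t a b : interp s t a b s = a.
Proof. by rewrite /interp subrr mulr0 addr0. Qed.

Lemma interpr s t a b : s != t -> interp s t a b t = b.
Proof.
by move=> st; rewrite /interp divfK ?subr_eq0 1?eq_sym // addrC subrK.
Qed.

Lemma interp_le s t a b r v : s < t ->
  (interp s t a b r <= v) = (a * (t - r) + b * (r - s) <= v * (t - s)).
Proof.
move=> st; have st0 : 0 < t - s by rewrite subr_gt0.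
rewrite -(ler_pM2r st0); congr (_ <= _); rewrite /interp.
by field; rewrite gt_eqF.
Qed.

Lemma interp_ge s t a b r v : s < t ->
  (v <= interp s t a b r) = (v * (t - s) <= a * (t - r) + b * (r - s)).
Proof.
move=> st; have st0 : 0 < t - s by rewrite subr_gt0.
rewrite -(ler_pM2r st0); congr (_ <= _); rewrite /interp.
by field; rewrite gt_eqF.
Qed.

Lemma interp_mono s t a b a' b' r : s < t -> s <= r -> r <= t ->
  a <= a' -> b <= b' -> interp s t a b r <= interp s t a' b' r.
Proof.
move=> st sr rt aa bb.
have E c d : interp s t c d r = (c * (t - r) + d * (r - s)) / (t - s).
  by rewrite /interp; field; rewrite gt_eqF ?subr_gt0.
by rewrite !E ler_pM2r ?invr_gt0 ?subr_gt0 // lerD // ler_wpM2r ?subr_ge0.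
Qed.

(** Both sides are the bilinear interpolation of four corner values, taken one variable at a time in
    either order. *)
Lemma interp_swap s t s' t' a b c d r r' :
  interp s t (interp s' t' a b r') (interp s' t' c d r') r =
  interp s' t' (interp s t a c r) (interp s t b d r) r'.
Proof. by rewrite /interp; ring. Qed.

(** Membership of [(a, t)] in the convex hull of the planar points [(x k, f k)]. *)
Definition mixture (I : finType) (x f : I -> R) a t :=
  exists l : I -> R, [/\ forall k, 0 <= l k, \sum_k l k = 1,
    \sum_k l k * x k = a & \sum_k l k * f k = t].

Lemma mixture_point (I : finType) (x f : I -> R) i : mixture x f (x i) (f i).
Proof.
have E g : \sum_k (k == i)%:R * g k = g i :> R.
  rewrite (bigD1 i) //= eqxx mul1r big1 ?addr0 // => k /negbTE ->.
  by rewrite mul0r.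
exists (fun k => (k == i)%:R); split => //.
by rewrite -[RHS](E (fun=> 1)); apply: eq_bigr => k _; rewrite mulr1.
Qed.

Lemma mixture_convex (I : finType) (x f : I -> R) a t a' t' s :
  0 <= s -> s <= 1 -> mixture x f a t -> mixture x f a' t' ->
  mixture x f (a + (a' - a) * s) (t + (t' - t) * s).
Proof.
move=> s0 s1 [l [l0 l1 <- <-]] [l' [l0' l1' <- <-]].
have E g : \sum_k ((1 - s) * l k + s * l' k) * g k =
    \sum_k l k * g k + (\sum_k l' k * g k - \sum_k l k * g k) * s.
  under eq_bigr do rewrite mulrDl -!mulrA.
  by rewrite big_split /= -!mulr_sumr; ring.
exists (fun k => (1 - s) * l k + s * l' k); split => //.
  by move=> k; rewrite addr_ge0 // mulr_ge0 // subr_ge0.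
by rewrite big_split /= -!mulr_sumr l1 l1'; ring.
Qed.

Lemma mixture_interp (I : finType) (x f : I -> R) s t a b r :
  s <= r -> r <= t -> mixture x f s a -> mixture x f t b ->
  mixture x f r (interp s t a b r).
Proof.
move=> sr rt Ms Mt.
have [st|st] := eqVneq s t.
  have -> : r = s by apply/eqP; rewrite eq_le sr st rt.
  by rewrite interpl.
have st0 : 0 < t - s by rewrite subr_gt0 lt_neqAle st (le_trans sr).
have -> : interp s t a b r = a + (b - a) * ((r - s) / (t - s)).
  by rewrite /interp; ring.
have -> : r = s + (t - s) * ((r - s) / (t - s)).
  by field; rewrite gt_eqF.
have -> : s + (t - s) * ((r - s) / (t - s)) - s = r - s.
  by field; rewrite gt_eqF.
apply: mixture_convex => //; first by rewrite divr_ge0 ?subr_ge0 // ltW // -subr_gt0.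
by rewrite ler_pdivrMr // mul1r lerD2r.
Qed.

Lemma mixture_between (I : finType) (x f : I -> R) a t t' v :
  mixture x f a t -> mixture x f a t' -> t <= v <= t' -> mixture x f a v.
Proof.
move=> Mt Mt' /andP[tv vt'].
have [tt|tt] := eqVneq t t'.
  by have <- : t = v by apply/eqP; rewrite eq_le tv tt vt'.
have tt0 : 0 < t' - t by rewrite subr_gt0 lt_neqAle tt (le_trans tv).
have -> : v = t + (t' - t) * ((v - t) / (t' - t)) by field; rewrite gt_eqF.
have -> : a = a + (a - a) * ((v - t) / (t' - t)) by rewrite subrr mul0r addr0.
apply: mixture_convex => //; first by rewrite divr_ge0 ?subr_ge0 // ltW // -subr_gt0.
by rewrite ler_pdivrMr // mul1r lerD2r.
Qed.

End Interpolation.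

(** * Vertical sections of a planar convex hull *)

Section Hull.
Variables (R : realType) (I : finType) (x : I -> R).

Definition chord (f : I -> R) (i : I) (k : I * I) : R :=
  interp (x k.1) (x k.2) (f k.1) (f k.2) (x i).

Definition spans (i : I) (k : I * I) := x k.1 <= x i <= x k.2.

(** The lower end of the hull's section at [x i]: in the plane it is attained on a chord between two
    of the points. The degenerate pair [(i, i)] keeps the range nonempty. *)
Definition lower (f : I -> R) (i : I) : R :=
  chord f i [arg min_(k < (i, i) | spans i k) chord f i k]%O.

Definition upper (f : I -> R) (i : I) : R :=
  chord f i [arg max_(k > (i, i) | spans i k) chord f i k]%O.

Lemma spans_diag i : spans i (i, i).
Proof. by rewrite /spans !lexx. Qed.

Lemma lower_chord f i k : spans i k -> lower f i <= chord f i k.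
Proof.
by rewrite /lower; case: arg_minP => [|k0 _ min0 /min0//]; exact: spans_diag.
Qed.

Lemma chord_upper f i k : spans i k -> chord f i k <= upper f i.
Proof.
by rewrite /upper; case: arg_maxP => [|k0 _ max0 /max0//]; exact: spans_diag.
Qed.

Lemma lower_le f i : lower f i <= f i.
Proof. by have := lower_chord f (spans_diag i); rewrite /chord interpl. Qed.

Lemma le_upper f i : f i <= upper f i.
Proof. by have := chord_upper f (spans_diag i); rewrite /chord interpl. Qed.

(** Both ends are chord values, hence lie in the hull, and convexity fills in the segment between
    them. *)
Lemma mixture_hull f i v : lower f i <= v <= upper f i -> mixture x f (x i) v.
Proof.
have M k : spans i k -> mixture x f (x i) (chord f i k).
  by case/andP=> *; apply: mixture_interp => //; exact: mixture_point.
apply: mixture_between.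
  by rewrite /lower; case: arg_minP => [|k0 s0 _]; [exact: spans_diag | exact: M].
by rewrite /upper; case: arg_maxP => [|k0 s0 _]; [exact: spans_diag | exact: M].
Qed.

End Hull.

(** * Sorting and medians of triples *)

Section Triples.
Variables (R : realType) (I : finType) (x : I -> R).
Hypothesis x_inj : injective x.

(** Adjacent transpositions generate all permutations, so a symmetric property need only be checked
    on sorted triples. *)
Lemma sorted3_ind (P : I -> I -> I -> Prop) :
  (forall a b c, P a b c -> P b a c) -> (forall a b c, P a b c -> P a c b) ->
  (forall a b c, x a <= x b -> x b <= x c -> P a b c) -> forall a b c, P a b c.
Proof.
move=> P12 P23 Ps a b c.
case: (leP (x a) (x b)) => [ab|/ltW ab]; case: (leP (x b) (x c)) => [bc|/ltW bc];
  case: (leP (x a) (x c)) => [ac|/ltW ac]; auto.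
Qed.

Definition median (a b c : I) : I :=
  if x a <= x b then if x b <= x c then b else if x a <= x c then c else a
  else if x a <= x c then a else if x b <= x c then c else b.

Lemma median12 a b c : median a b c = median b a c.
Proof.
rewrite /median.
by case: (ltgtP (x a) (x b)) => [ab|ab|/x_inj->]//; case: (ltgtP (x b) (x c)) => [bc|bc|/x_inj ?];
  case: (ltgtP (x a) (x c)) => [ac|ac|/x_inj ?]//; subst => //; exfalso; lra.
Qed.

Lemma median23 a b c : median a b c = median a c b.
Proof.
rewrite /median.
by case: (ltgtP (x b) (x c)) => [bc|bc|/x_inj->]//; case: (ltgtP (x a) (x b)) => [ab|ab|/x_inj ?];
  case: (ltgtP (x a) (x c)) => [ac|ac|/x_inj ?]//; subst => //; exfalso; lra.
Qed.

Lemma median_sorted a b c : x a <= x b -> x b <= x c -> median a b c = b.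
Proof. by rewrite /median => -> ->. Qed.

End Triples.

(** * Common transversals of vertical segments *)

Section Transversals.
Variables (R : realType) (J : finType) (y : J -> R).
Hypothesis y_inj : injective y.
Variables (l u : J -> R).
Hypothesis lu : forall j, l j <= u j.

Definition hit (g : R -> R) (k : J) := l k <= g (y k) <= u k.

(* For [y j < y k] this is the line of least slope meeting both segments
   [{y j} * [l j, u j]] and [{y k} * [l k, u k]]. *)
Definition extremal (j k : J) : R -> R :=
  if y j <= y k then interp (y j) (y k) (u j) (l k)
  else interp (y k) (y j) (u k) (l j).

Definition pierced (a b c : J) : bool :=
  [|| hit (extremal a b) c, hit (extremal a c) b | hit (extremal b c) a].

Lemma extremalC j k : extremal j k = extremal k j.
Proof. by rewrite /extremal; case: (ltgtP (y j) (y k)) => // /y_inj ->. Qed.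

Lemma pierced12 a b c : pierced a b c = pierced b a c.
Proof. by rewrite /pierced (extremalC b a); do 3!case: hit. Qed.

Lemma pierced23 a b c : pierced a b c = pierced a c b.
Proof. by rewrite /pierced (extremalC c b); do 3!case: hit. Qed.

Lemma hit_extremal_l j k : hit (extremal j k) j.
Proof.
rewrite /hit /extremal; case: (leP (y j) (y k)) => [_|kj].
  by rewrite interpl lexx lu.
by rewrite interpr ?lt_eqF // lexx lu.
Qed.

(** An extremal line meets the segments that define it, so triples with a repeated index count as
    pierced. *)
Lemma pierced_diag12 a c : pierced a a c.
Proof. by rewrite /pierced hit_extremal_l !orbT. Qed.

Lemma pierced_diag23 a b : pierced a b b.
Proof. by rewrite pierced12 pierced23 pierced_diag12. Qed.

(* The two hypotheses say that the middle segment lies neither above all the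
   chords of the outer two nor below all of them. *)
Lemma pierced_sorted a b c : y a < y b -> y b < y c ->
  l b <= interp (y a) (y c) (u a) (u c) (y b) ->
  interp (y a) (y c) (l a) (l c) (y b) <= u b -> pierced a b c.
Proof.
move=> ab bc; have ac := lt_trans ab bc.
rewrite interp_ge // interp_le // => hl hu.
rewrite /pierced /hit /extremal (ltW ab) (ltW bc) (ltW ac) !interp_le // !interp_ge //.
have la := lu a; have lc := lu c; have lb := lu b.
(* Test the line from [u a] to [l c] at [b]. If it misses the middle segment from above, the line
   from [u b] to [l c] meets segment [a]; if from below, the line from [u a] to [l b] meets segment
   [c]. *)
have [v1|v1] := leP (l b * (y c - y a)) (u a * (y c - y b) + l c * (y b - y a)).
  have [v2|v2] := leP (u a * (y c - y b) + l c * (y b - y a)) (u b * (y c - y a)).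
    by rewrite orbT.
  by apply/orP; right; rewrite andbF /=; apply/andP; split; lra.
by apply/orP; left; apply/andP; split; lra.
Qed.

Lemma pierced_transversal :
  (#|{: J * J * J}| <= 2 * #|[set t | pierced t.1.1 t.1.2 t.2]|)%N ->
  exists g d : R, (#|J| <= 6 * #|[set k | hit (fun s => g + d * s)%R k]|)%N.
Proof.
move=> half; have [J0|/card_gt0P[j0 _]] := posnP #|J|.
  by exists 0, 0; rewrite J0.
have [q qJ] : exists q, #|J| = q by exists #|J|.
have q_gt0 : (0 < q)%N by rewrite -qJ; apply/card_gt0P; exists j0.
have J2 : #|{: J * J}| = (q * q)%N by rewrite card_prod qJ.
have J3 : #|{: J * J * J}| = (q * q * q)%N by rewrite !card_prod qJ.
pose N (p : J * J) := #|[set k | hit (extremal p.1 p.2) k]|.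
have [p Np] : exists p, (#|J| <= 6 * N p)%N.
  apply/existsP; apply: contraT => /existsPn none.
  pose A := [set t : J * J * J | hit (extremal t.1.1 t.1.2) t.2].
  have cardA : (#|A| = \sum_p N p)%N.
    rewrite -sum1_card big_mkcond /=.
    under eq_bigr do rewrite inE.
    rewrite -(pair_bigA _ (fun p k => if hit (extremal p.1 p.2) k then 1 else 0)%N) /=.
    by apply: eq_bigr => p _; rewrite /N cardsE -sum1_card [RHS]big_mkcond.
  have E1 : (#|[set t | pierced t.1.1 t.1.2 t.2]| <= 3 * \sum_p N p)%N.
    (* [f] and [g] move the index outside the chosen pair to the last place, so three copies of [A]
       cover the pierced triples. *)
    pose f (t : J * J * J) := (t.1.1, t.2, t.1.2).
    pose g (t : J * J * J) := (t.1.2, t.2, t.1.1).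
    have f_inj : injective f by move=> [[a b] c] [[a' b'] c'] [-> -> ->].
    have g_inj : injective g by move=> [[a b] c] [[a' b'] c'] [-> -> ->].
    have sub : [set t | pierced t.1.1 t.1.2 t.2] \subset
        A :|: f @^-1: A :|: g @^-1: A.
      by apply/subsetP => t; rewrite !inE -orbA.
    apply: leq_trans (subset_leq_card sub) _.
    have := cardsU (A :|: f @^-1: A) (g @^-1: A).
    have := cardsU A (f @^-1: A).
    by rewrite !card_preimset // !cardA; lia.
  (* Strict failure leaves a slack of one for each of the [q * q] pairs, which contradicts [half]
     and [E1]. *)
  have E2 : (6 * \sum_p N p + q * q <= q * q * q)%N.
    rewrite -J2 -sum_mulS -sum_nat_const.
    by apply: leq_sum => p _; rewrite ltnNge -qJ.
  by move: half; rewrite J3; nia.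
have affine s t a b : exists g d : R, forall r, interp s t a b r = g + d * r.
  exists (a - (b - a) / (t - s) * s), ((b - a) / (t - s)) => r.
  by rewrite /interp; ring.
have [g [d gd]] : exists g d : R, forall r, extremal p.1 p.2 r = g + d * r.
  by rewrite /extremal; case: ifP => _; exact: affine.
exists g, d; apply: leq_trans Np _; rewrite leq_mul2l /=.
by apply: subset_leq_card; apply/subsetP => k; rewrite !inE /hit gd.
Qed.

End Transversals.

(** * The dichotomy for a three-by-three grid *)

(** Unprimed bounds are the segments of the middle row, primed ones those of the middle column. Each
    alternative supplies the hypotheses of [pierced_sorted]. *)
Lemma middle_row_or_column (R : realType) (x1 x2 x3 y1 y2 y3 : R)
  (z11 z12 z13 z21 z22 z23 z31 z32 z33 : R)
  (l1 u1 l2 u2 l3 u3 l1' u1' l2' u2' l3' u3' : R) :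
  x1 < x2 -> x2 < x3 -> y1 < y2 -> y2 < y3 ->
  l1 <= z21 <= u1 -> l2 <= z22 <= u2 -> l3 <= z23 <= u3 ->
  l1 <= interp x1 x3 z11 z31 x2 <= u1 ->
  l2 <= interp x1 x3 z12 z32 x2 <= u2 ->
  l3 <= interp x1 x3 z13 z33 x2 <= u3 ->
  l1' <= z12 <= u1' -> l2' <= z22 <= u2' -> l3' <= z32 <= u3' ->
  l1' <= interp y1 y3 z11 z13 y2 <= u1' ->
  l2' <= interp y1 y3 z21 z23 y2 <= u2' ->
  l3' <= interp y1 y3 z31 z33 y2 <= u3' ->
  (l2 <= interp y1 y3 u1 u3 y2 /\ interp y1 y3 l1 l3 y2 <= u2) \/
  (l2' <= interp x1 x3 u1' u3' x2 /\ interp x1 x3 l1' l3' x2 <= u2').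
Proof.
move=> x12 x23 y12 y23.
move=> /andP[a1 b1] /andP[a2 b2] /andP[a3 b3] /andP[c1 d1] /andP[c2 d2] /andP[c3 d3].
move=> /andP[a1' b1'] /andP[a2' b2'] /andP[a3' b3'].
move=> /andP[c1' d1'] /andP[c2' d2'] /andP[c3' d3'].
have swap := interp_swap x1 x3 y1 y3 z11 z13 z31 z33 x2 y2.
have my a b a' b' : a <= a' -> b <= b' -> interp y1 y3 a b y2 <= interp y1 y3 a' b' y2.
  by apply: interp_mono; lra.
have mx a b a' b' : a <= a' -> b <= b' -> interp x1 x3 a b x2 <= interp x1 x3 a' b' x2.
  by apply: interp_mono; lra.
(* By monotonicity the row's end chords enclose v and c, and the column's enclose w and c; [swap]
   identifies the two forms of c. *)
have := my _ _ _ _ b1 b3; have := my _ _ _ _ a1 a3.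
have := my _ _ _ _ d1 d3; have := my _ _ _ _ c1 c3.
have := mx _ _ _ _ b1' b3'; have := mx _ _ _ _ a1' a3'.
have := mx _ _ _ _ d1' d3'; have := mx _ _ _ _ c1' c3'.
move=> *.
case: (leP l2 (interp y1 y3 u1 u3 y2)) => r1;
  case: (leP (interp y1 y3 l1 l3 y2) u2) => r2; try by left.
(* Row failure puts [z22] on the same side of c as w of v; column failure requires opposite
   sides. *)
all: right; split; lra.
Qed.

(** * From triples to a rich line in the grid *)

Section Grid.
Variables (R : realType) (I J : finType) (x : I -> R) (y : J -> R).
Hypotheses (x_inj : injective x) (y_inj : injective y).
Variable z : I -> J -> R.

(** [rowl] and [rowu] bound the section of B_j by the plane x = x_i; [coll] and [colu] bound that of
    A_i by y = y_j. *)
Let rowl i j := lower x (z^~ j) i.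
Let rowu i j := upper x (z^~ j) i.
Let coll j i := lower y (z i) j.
Let colu j i := upper y (z i) j.

(** Symmetry of medians and piercing allows both triples to be sorted; a repeated index settles one
    alternative at once. *)
Lemma pierced_row_or_column a b c a' b' c' :
  pierced y (rowl (median x a b c)) (rowu (median x a b c)) a' b' c' ||
  pierced x (coll (median y a' b' c')) (colu (median y a' b' c')) a b c.
Proof.
have row_lu i j : rowl i j <= rowu i j := le_trans (lower_le _ _ _) (le_upper _ _ _).
have col_lu j i : coll j i <= colu j i := le_trans (lower_le _ _ _) (le_upper _ _ _).
move: a' b' c'; move: a b c; apply: (sorted3_ind (x := x)).
- by move=> a b c P ? ? ?; rewrite median12 // [pierced x _ _ b a c]pierced12.
- by move=> a b c P ? ? ?; rewrite median23 // [pierced x _ _ a c b]pierced23.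
move=> a b c ab bc; rewrite median_sorted //; apply: (sorted3_ind (x := y)).
- by move=> a' b' c'; rewrite [median y b' _ _]median12 // [pierced y _ _ b' _ _]pierced12.
- by move=> a' b' c'; rewrite [median y _ c' _]median23 // [pierced y _ _ _ c' _]pierced23.
move=> a' b' c' ab' bc'; rewrite median_sorted //.
have [/x_inj ->|nab] := eqVneq (x a) (x b).
  by rewrite pierced_diag12 // orbT.
have [/x_inj ->|nbc] := eqVneq (x b) (x c).
  by rewrite (pierced_diag23 x_inj) // orbT.
have [/y_inj ->|nab'] := eqVneq (y a') (y b'); first by rewrite pierced_diag12.
have [/y_inj ->|nbc'] := eqVneq (y b') (y c'); first by rewrite (pierced_diag23 y_inj).
have {nab}ab1 : x a < x b by rewrite lt_neqAle nab.
have {nbc}bc1 : x b < x c by rewrite lt_neqAle nbc.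
have {nab'}ab1' : y a' < y b' by rewrite lt_neqAle nab'.
have {nbc'}bc1' : y b' < y c' by rewrite lt_neqAle nbc'.
have row_point j : rowl b j <= z b j <= rowu b j.
  by rewrite /rowl /rowu (lower_le x (z^~ j)) (le_upper x (z^~ j)).
have col_point i : coll b' i <= z i b' <= colu b' i by rewrite /coll /colu lower_le le_upper.
have row_chord j : rowl b j <= interp (x a) (x c) (z a j) (z c j) (x b) <= rowu b j.
  have sp : spans x b (a, c) by apply/andP.
  by rewrite (lower_chord (z^~ j) sp) (chord_upper (z^~ j) sp).
have col_chord i : coll b' i <= interp (y a') (y c') (z i a') (z i c') (y b') <= colu b' i.
  have sp : spans y b' (a', c') by apply/andP.
  by rewrite (lower_chord (z i) sp) (chord_upper (z i) sp).
have [[h1 h2]|[h1 h2]] := middle_row_or_column ab1 bc1 ab1' bc1'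
  (row_point a') (row_point b') (row_point c')
  (row_chord a') (row_chord b') (row_chord c')
  (col_point a) (col_point b) (col_point c)
  (col_chord a) (col_chord b) (col_chord c).
  by rewrite pierced_sorted.
by rewrite orbC pierced_sorted.
Qed.

Lemma grid_transversal : (0 < #|I|)%N -> (0 < #|J|)%N ->
  (exists (i : I) (g d : R), (#|J| <= 6 * #|[set j | (rowl i j <= g + d * y j <= rowu i j)%R]|)%N) \/
  (exists (j : J) (g d : R), (#|I| <= 6 * #|[set i | (coll j i <= g + d * x i <= colu j i)%R]|)%N).
Proof.
move=> I0 J0.
pose mI (t : I * I * I) := median x t.1.1 t.1.2 t.2.
pose mJ (t : J * J * J) := median y t.1.1 t.1.2 t.2.
have [||t s|[t Ht]|[s Hs]] := @pigeonhole_half (I * I * I)%type (J * J * J)%type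
  (fun t s => pierced y (rowl (mI t)) (rowu (mI t)) s.1.1 s.1.2 s.2)
  (fun t s => pierced x (coll (mJ s)) (colu (mJ s)) t.1.1 t.1.2 t.2).
- by rewrite !card_prod !muln_gt0 I0.
- by rewrite !card_prod !muln_gt0 J0.
- exact: pierced_row_or_column.
- by left; exists (mI t); exact: pierced_transversal Ht.
- by right; exists (mJ s); exact: pierced_transversal Hs.
Qed.

End Grid.

(** * Return to three-dimensional space *)

Lemma lt_ord_inj (R : realType) (n : nat) (x : 'I_n -> R) :
  (forall i i' : 'I_n, (i < i')%N -> x i < x i') -> injective x.
Proof.
move=> xlt i i' xi; apply: val_inj => /=.
by case: (ltngtP i i') => // /xlt; rewrite xi ltxx.
Qed.

Lemma le_card_div6 (R : realType) (n k : nat) :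
  (n <= 6 * k)%N -> (n%:R / 6 : R) <= k%:R.
Proof. by move=> nk; rewrite ler_pdivrMr // mulrC -natrM ler_nat. Qed.

Theorem theorem2 (R : realType) (n m : nat) (x : 'I_n -> R) (y : 'I_m -> R)
  (z : 'M[R]_(n, m)) :
  (0 < n)%N -> (0 < m)%N ->
  (forall i i' : 'I_n, (i < i')%N -> x i < x i') ->
  (forall j j' : 'I_m, (j < j')%N -> y j < y j') ->
  (exists (i : 'I_n) (p d : pt3 R) (S : {set 'I_m}),
      d != ((0, 0, 0) : pt3 R) /\
      (forall q, on_line p d q -> px q = x i) /\
      (m%:R / 6 : R) <= #|S|%:R /\
      (forall j, j \in S -> exists q, on_line p d q /\
                   in_conv (fun i' : 'I_n => Pt x y z i' j) q))
  \/
  (exists (j : 'I_m) (p d : pt3 R) (S : {set 'I_n}),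
      d != ((0, 0, 0) : pt3 R) /\
      (forall q, on_line p d q -> py q = y j) /\
      (n%:R / 6 : R) <= #|S|%:R /\
      (forall i, i \in S -> exists q, on_line p d q /\
                   in_conv (fun j' : 'I_m => Pt x y z i j') q)).
Proof.
move=> n0 m0 /lt_ord_inj x_inj /lt_ord_inj y_inj.
have [||[i [g [d Hi]]]|[j [g [d Hj]]]] :=
  grid_transversal x_inj y_inj (fun i j => z i j); rewrite ?card_ord //.
(* The line is the graph z = g + d y in the plane x = x_i, parametrised by y itself. *)
- left; exists i, (x i, 0, g), (0, 1, d),
    [set j : 'I_m | lower x (z^~ j) i <= g + d * y j <= upper x (z^~ j) i]; split.
    by rewrite !xpair_eqE oner_eq0 andbF.
  split; first by move=> _ [t ->]; rewrite /px /= mulr0 addr0.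
  split; first by apply: le_card_div6; rewrite card_ord in Hi; exact: Hi.
  move=> j; rewrite inE => /mixture_hull[l [l0 l1 lx lz]].
  exists (x i, y j, g + d * y j); split.
    by exists (y j); rewrite /px /py /pz /= mulr0 addr0 mulr1 add0r mulrC.
  (* All generators of B_j share the coordinate [y j], which weights of sum 1 reproduce. *)
  exists l; split=> //; split=> //.
  by rewrite /px /py /pz /= lx lz -mulr_suml l1 mul1r.
- right; exists j, (0, y j, g), (1, 0, d),
    [set i : 'I_n | lower y (z i) j <= g + d * x i <= upper y (z i) j]; split.
    by rewrite !xpair_eqE oner_eq0.
  split; first by move=> _ [t ->]; rewrite /py /= mulr0 addr0.
  split; first by apply: le_card_div6; rewrite card_ord in Hj; exact: Hj.
  move=> i; rewrite inE => /mixture_hull[l [l0 l1 ly lz]].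
  exists (x i, y j, g + d * x i); split.
    by exists (x i); rewrite /px /py /pz /= mulr0 addr0 mulr1 add0r mulrC.
  exists l; split=> //; split=> //.
  by rewrite /px /py /pz /= ly lz -mulr_suml l1 mul1r.
Qed.
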